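(* Let $X=c_0(\mathbb{Z}_+)$ or $X=\ell^p(\mathbb{Z}_+)$ with $1\le p<\infty$. Then there exists a continuous linear operator on $X$ which is topologically multiply recurrent but not topologically $\mathcal{D}$-recurrent.
   Context: $\mathbb{N}=\{1,2,3,\dots\}$, $\mathbb{Z}_+=\{0,1,2,\dots\}$; spaces are over $\mathbb{C}$. For $A\subseteq\mathbb{N}$, the upper Banach density is $\overline{Bd}(A)=\lim_{s\to\infty}\alpha^s/s$ with $\alpha^s=\limsup_{k\to\infty}|A\cap[k+1,k+s]|$. $T$ is topologically multiply recurrent if for every non-empty open set $U\subseteq X$ and every $r\in\mathbb{N}$ there is some $k\in\mathbb{N}$ such that $U\cap T^{-k}U\cap\cdots\cap T^{-rk}U\neq\emptyset$. $\beta\mathbb{N}$ is the set of ultrafilters on $\mathbb{N}$, with the operation: $A\in p+q$ if and only if $\{n\in\mathbb{N}: -n+A\in q\}\in p$, where $-n+A=\{m\in\mathbb{N}: n+m\in A\}$. An essential idempotent is a $p\in\beta\mathbb{N}$ with $p+p=p$ such that every member of $p$ has positive upper Banach density. $T$ is topologically $\mathcal{D}$-recurrent if there exists an essential idempotent $q$ such that for every non-empty open set $U\subseteq X$ there exists $x\in X$ such that for every $r\in\mathbb{N}$, $$\Big\{k\in\mathbb{N}: \overline{Bd}\Big(\Big\{a\in\mathbb{N}: T^ax\in\bigcap_{j=0}^{r}T^{-jk}(U)\Big\}\Big)>0\Big\}\in q.$$ *)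

(* Defs.v *)
From HB Require Import structures.
From mathcomp Require Import all_boot all_order all_algebra.
From mathcomp Require Import complex.
From mathcomp Require Import all_classical all_reals all_analysis.

Set Implicit Arguments.
Unset Strict Implicit.
Unset Printing Implicit Defensive.

Import Order.TTheory GRing.Theory Num.Theory.
Import numFieldNormedType.Exports.
Import ComplexField.Normc.

Local Open Scope classical_set_scope.
Local Open Scope ring_scope.
Local Open Scope complex_scope.

Section Modulus.
Context {R : realType}.
Implicit Types z w : R[i].

Lemma normr_normc z : `|z| = (normc z)%:C.
Proof. by case: z. Qed.

Lemma normc_ge0 z : 0 <= normc z.
Proof. by case: z => a b; exact: sqrtr_ge0. Qed.

Lemma ler_normcD z w : normc (z + w) <= normc z + normc w.
Proof. by rewrite -lecR rmorphD/= -!normr_normc ler_normD. Qed.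

Lemma cvg_normc0 (x : nat -> R[i]^o) :
  x @ \oo --> (0 : R[i]^o) <-> (fun n => normc (x n)) @ \oo --> (0 : R).
Proof.
split.
- move=> /cvgr0Pnorm_lt h; apply/cvgr0Pnorm_lt => e e0.
  have := h e%:C; rewrite ltcR => /(_ e0); apply: filterS => n.
  by rewrite (normr_normc (x n)) ltcR (ger0_norm (normc_ge0 _)).
- move=> /cvgr0Pnorm_lt h; apply/cvgr0Pnorm_lt => e e0.
  have eE : e = (complex.Re e)%:C by rewrite RRe_real// gtr0_real.
  have e0' : 0 < complex.Re e by rewrite -ltcR -eE.
  have := h _ e0'; apply: filterS => n.
  by rewrite (normr_normc (x n)) eE ltcR (ger0_norm (normc_ge0 _)).
Qed.

End Modulus.

Definition c0_norm (R : realType) (x : nat -> R[i]) : R :=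
  sup (range (fun n => normc (x n))).

Definition c0_pred (R : realType) : {pred nat -> R[i]} :=
  fun x => `[< (x : nat -> R[i]^o) @ \oo --> (0 : R[i]^o) >].
Arguments c0_pred R : clear implicits.

Definition lp_sum (R : realType) (p : R) (x : nat -> R[i]) : \bar R :=
  (\sum_(0 <= n <oo) (normc (x n) `^ p)%:E)%E.

Definition lp_norm (R : realType) (p : R) (x : nat -> R[i]) : R :=
  fine (lp_sum p x) `^ p^-1.

(* The proof of 1 <= p is a phantom argument on which the normed module
   structure below relies. *)
Definition lp_pred (R : realType) (p : R) (p1 : 1 <= p) :
  {pred nat -> R[i]} := fun x => (lp_sum p x < +oo)%E.

Section C0Theory.
Context {R : realType}.
Implicit Types x y : nat -> R[i].

Lemma c0P x : x \in c0_pred R <-> (fun n => normc (x n)) @ \oo --> (0 : R).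
Proof. by rewrite -cvg_normc0; split => [/asboolP|h]//; exact/asboolP. Qed.

Lemma c0_submod_closed : submod_closed (c0_pred R).
Proof.
split.
  apply/c0P; rewrite (_ : (fun _ => _) = cst 0); first exact: cvg_cst.
  by apply/funext => n; rewrite normc0.
move=> a x y /c0P cx /c0P cy; apply/c0P.
apply: (@squeeze_cvgr _ _ _ _ (cst 0)
  (fun n => normc a * normc (x n) + normc (y n))).
- near=> n; rewrite normc_ge0/= (le_trans (ler_normcD _ _))//.
  by rewrite lerD2r normcM.
- exact: cvg_cst.
- rewrite -[X in _ --> X](addr0 (0 : R)) -{1}(mulr0 (normc a)).
  by apply: cvgD => //; exact: cvgMl_tmp.
Unshelve. all: by end_near. Qed.

HB.instance Definition _ :=
  GRing.isSubmodClosed.Build R[i] (nat -> R[i]) (c0_pred R) c0_submod_closed.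

Lemma c0_has_sup x : x \in c0_pred R ->
  has_sup (range (fun n => normc (x n))).
Proof.
move=> /c0P cx; split; first by exists (normc (x 0%N)), 0%N.
have /bounded_fun_has_ubound// : bounded_fun (fun n => normc (x n)).
by apply: cvg_seq_bounded; apply/cvg_ex; exists 0.
Qed.

Lemma normc_le_c0_norm x n : x \in c0_pred R -> normc (x n) <= c0_norm x.
Proof. by move=> /c0_has_sup[_ ub]; apply: ub_le_sup => //; exists n. Qed.

Lemma c0_norm_le x r :
  (forall n, normc (x n) <= r) -> c0_norm x <= r.
Proof.
by move=> h; apply: ge_sup => [|_ [n _ <-]]; [exists (normc (x 0%N)), 0%N|].
Qed.

Lemma ler_c0_normD x y : x \in c0_pred R -> y \in c0_pred R ->
  c0_norm (x + y) <= c0_norm x + c0_norm y.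
Proof.
move=> hx hy; apply: c0_norm_le => n.
by rewrite (le_trans (ler_normcD _ _))// lerD// normc_le_c0_norm.
Qed.

Lemma c0_normZ a x : x \in c0_pred R ->
  c0_norm (a *: x) = normc a * c0_norm x.
Proof.
move=> hx; apply/eqP; rewrite eq_le; apply/andP; split.
  apply: c0_norm_le => n.
  by rewrite normcM ler_wpM2l ?normc_ge0// normc_le_c0_norm.
have [->|a0] := eqVneq a 0.
  by rewrite normc0 mul0r scale0r (le_trans (normc_ge0 0))//
    (@normc_le_c0_norm 0 0%N)// rpred0.
have na0 : 0 < normc a.
  by rewrite lt_neqAle normc_ge0 andbT eq_sym; apply: contra a0 => /eqP/eq0_normc->.
rewrite mulrC -ler_pdivlMr//; apply: c0_norm_le => n.
rewrite ler_pdivlMr// mulrC -normcM.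
by apply: (@normc_le_c0_norm (a *: x)); rewrite rpredZ.
Qed.

Lemma c0_norm0_eq0 x : x \in c0_pred R -> c0_norm x = 0 -> x = 0.
Proof.
move=> hx x0; apply/funext => n; apply: eq0_normc.
by apply/eqP; rewrite eq_le normc_ge0 andbT -x0 normc_le_c0_norm.
Qed.

End C0Theory.

Section LpTheory.
Context {R : realType} (p : R) (p1 : 1 <= p).
Implicit Types x y : nat -> R[i].

Let p0 : 0 < p. Proof. exact: lt_le_trans p1. Qed.

Lemma lp_sum_ge0 x : (0 <= lp_sum p x)%E.
Proof. by apply: nneseries_ge0 => n _ _; rewrite lee_fin powR_ge0. Qed.

Lemma lp_sum_fin x : x \in lp_pred p1 -> lp_sum p x \is a fin_num.
Proof. by rewrite ge0_fin_numE ?lp_sum_ge0. Qed.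

Let lp_sumE x :
  lp_sum p x = ('N[counting]_p%:E[(EFin \o (fun n => normc (x n)))%R] `^ p)%E.
Proof.
rewrite Lnorm_counting// -poweRrM mulVf ?gt_eqF// poweRe1 //; last first.
  by apply: nneseries_ge0 => n _ _; rewrite poweR_ge0.
by apply: eq_eseriesr => n _; rewrite gee0_abs ?poweR_EFin// lee_fin normc_ge0.
Qed.

Lemma lp_norm_Lnorm x : x \in lp_pred p1 -> (lp_norm p x)%:E =
  'N[counting]_p%:E[(EFin \o (fun n => normc (x n)))%R]%E.
Proof.
move=> hx; rewrite /lp_norm -poweR_EFin fineK ?lp_sum_fin// lp_sumE -poweRrM.
by rewrite mulfV ?gt_eqF// poweRe1// Lnorm_ge0.
Qed.

Let lp_predE x : (x \in lp_pred p1) =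
  ('N[counting]_p%:E[(EFin \o (fun n => normc (x n)))%R] < +oo)%E.
Proof.
apply/idP/idP => [hx|h]; first by rewrite -lp_norm_Lnorm// ltry.
by rewrite /in_mem/= /lp_pred lp_sumE poweR_lty.
Qed.

Let Lnorm_le (f g : nat -> R) : (forall n, 0 <= f n <= g n) ->
  ('N[counting]_p%:E[EFin \o f] <= 'N[counting]_p%:E[EFin \o g])%E.
Proof.
move=> fg; rewrite !Lnorm_counting//; apply: gt0_ler_poweR.
- by rewrite invr_ge0 ltW.
- by rewrite in_itv/= leey andbT nneseries_ge0// => n _ _; exact: poweR_ge0.
- by rewrite in_itv/= leey andbT nneseries_ge0// => n _ _; exact: poweR_ge0.
apply: lee_nneseries => [n _ _|n _]; first exact: poweR_ge0.
have /andP[f0 le_fg] := fg n; have g0 := le_trans f0 le_fg.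
rewrite /= !ger0_norm// lee_fin.
by rewrite ge0_ler_powR ?nnegrE ?(ltW p0).
Qed.

Let Lnorm_lpD x y :
  ('N[counting]_p%:E[EFin \o (fun n => normc ((x + y)%R n))] <=
   'N[counting]_p%:E[EFin \o (fun n => normc (x n))] +
   'N[counting]_p%:E[EFin \o (fun n => normc (y n))])%E.
Proof.
apply: (@le_trans _ _ ('N[counting]_p%:E[EFin \o
    ((fun n => normc (x n)) \+ (fun n => normc (y n)))%R])%E).
  by apply: Lnorm_le => n; rewrite normc_ge0 ler_normcD.
exact: minkowski_EFin.
Qed.

Lemma lp_sumZ a x : lp_sum p (a *: x) = ((normc a `^ p)%:E * lp_sum p x)%E.
Proof.
rewrite -nneseriesZl; last by move=> n _; rewrite lee_fin powR_ge0.
by apply: eq_eseriesr => n _; rewrite normcM powRM ?normc_ge0// EFinM.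
Qed.

Lemma lp_submod_closed : submod_closed (lp_pred p1).
Proof.
split.
  rewrite /in_mem/= /lp_pred/= /lp_sum eseries0// => n _ _.
  by rewrite normc0 powR0 ?gt_eqF.
move=> a x y hx hy; rewrite lp_predE (le_lt_trans (Lnorm_lpD _ _))//.
apply: lte_add_pinfty; last by rewrite -lp_predE.
rewrite -lp_predE /in_mem/= /lp_pred lp_sumZ.
apply: lte_mul_pinfty; [by rewrite lee_fin powR_ge0|by []|exact: hx].
Qed.

HB.instance Definition _ := GRing.isSubmodClosed.Build R[i] (nat -> R[i])
  (lp_pred p1) lp_submod_closed.

Lemma ler_lp_normD x y : x \in lp_pred p1 -> y \in lp_pred p1 ->
  lp_norm p (x + y) <= lp_norm p x + lp_norm p y.
Proof.
move=> hx hy; have hxy : x + y \in lp_pred p1 by exact: rpredD.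
have le_fin (a b c : R) (A B C : \bar R) : a%:E = A -> b%:E = B -> c%:E = C ->
    (A <= B + C)%E -> a <= b + c.
  by move=> <- <- <-; rewrite -EFinD lee_fin.
exact: (le_fin _ _ _ _ _ _ (lp_norm_Lnorm hxy) (lp_norm_Lnorm hx)
  (lp_norm_Lnorm hy) (Lnorm_lpD x y)).
Qed.

Lemma lp_normZ a x : x \in lp_pred p1 ->
  lp_norm p (a *: x) = normc a * lp_norm p x.
Proof.
move=> hx; rewrite /lp_norm lp_sumZ fineM ?lp_sum_fin//=.
rewrite powRM ?powR_ge0 ?fine_ge0 ?lp_sum_ge0//.
by rewrite -powRrM mulfV ?gt_eqF// powRr1 ?normc_ge0.
Qed.

Lemma normc_le_lp_norm x n : x \in lp_pred p1 -> normc (x n) <= lp_norm p x.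
Proof.
move=> hx; rewrite -[leLHS]powRr1 ?normc_ge0// -(mulfV (lt0r_neq0 p0)) powRrM.
rewrite ge0_ler_powR ?invr_ge0 ?(ltW p0) ?nnegrE ?powR_ge0//.
  by rewrite fine_ge0// lp_sum_ge0.
rewrite -lee_fin fineK ?lp_sum_fin// /lp_sum (nneseriesD1 (n := n))//; last first.
  by move=> k _; rewrite lee_fin powR_ge0.
by rewrite leeDl// nneseries_ge0// => k _ _; rewrite lee_fin powR_ge0.
Qed.

Lemma lp_norm0_eq0 x : x \in lp_pred p1 -> lp_norm p x = 0 -> x = 0.
Proof.
move=> hx x0; apply/funext => n; apply: eq0_normc.
by apply/eqP; rewrite eq_le normc_ge0 andbT -x0 normc_le_lp_norm.
Qed.

End LpTheory.

(* A normed R[i]-module takes its norm in R[i], hence the injections _%:C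
   of the real norms. *)

Section C0Space.
Context {R : realType}.

Record c0 := C0 { c0_val :> nat -> R[i] ; c0_valP : c0_val \in c0_pred R }.

HB.instance Definition _ := [isSub for c0_val].
HB.instance Definition _ := [Choice of c0 by <:].
HB.instance Definition _ := [SubChoice_isSubLmodule of c0 by <:].

Let c0_normC (x : c0) : R[i] := (c0_norm x)%:C.

Let ler_c0_normCD x y : c0_normC (x + y) <= c0_normC x + c0_normC y.
Proof. by rewrite -rmorphD lecR ler_c0_normD// c0_valP. Qed.

Let c0_normCZ (l : R[i]) x : c0_normC (l *: x) = `|l| * c0_normC x.
Proof. by rewrite normr_normc -rmorphM/= -c0_normZ ?c0_valP. Qed.

Let c0_normC0_eq0 x : c0_normC x = 0 -> x = 0.
Proof. by move=> [x0]; apply/val_inj/c0_norm0_eq0; rewrite ?c0_valP. Qed.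

HB.instance Definition _ := Lmodule_isNormed.Build R[i] c0
  ler_c0_normCD c0_normCZ c0_normC0_eq0.

End C0Space.
Arguments c0 R : clear implicits.

Section LpSpace.
Context {R : realType} (p : R) (p1 : 1 <= p).

Record lp := Lp { lp_val :> nat -> R[i] ; lp_valP : lp_val \in lp_pred p1 }.

HB.instance Definition _ := [isSub for lp_val].
HB.instance Definition _ := [Choice of lp by <:].
HB.instance Definition _ := [SubChoice_isSubLmodule of lp by <:].

Let lp_normC (x : lp) : R[i] := (lp_norm p x)%:C.

Let ler_lp_normCD x y : lp_normC (x + y) <= lp_normC x + lp_normC y.
Proof. by rewrite -rmorphD lecR (ler_lp_normD (p1 := p1))// lp_valP. Qed.

Let lp_normCZ (l : R[i]) x : lp_normC (l *: x) = `|l| * lp_normC x.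
Proof. by rewrite normr_normc -rmorphM/= -(lp_normZ (p1 := p1)) ?lp_valP. Qed.

Let lp_normC0_eq0 x : lp_normC x = 0 -> x = 0.
Proof.
by move=> [x0]; apply/val_inj/(lp_norm0_eq0 (p1 := p1)); rewrite ?lp_valP.
Qed.

HB.instance Definition _ := Lmodule_isNormed.Build R[i] lp
  ler_lp_normCD lp_normCZ lp_normC0_eq0.

End LpSpace.

Lemma c0_normE (R : realType) (x : c0 R) : `|x| = (c0_norm x)%:C.
Proof. by []. Qed.

Lemma lp_normE (R : realType) (p : R) (p1 : 1 <= p) (x : lp p1) :
  `|x| = (lp_norm p x)%:C.
Proof. by []. Qed.

(* The positive integers are represented inside nat: a subset of them is a
   A : set nat, of which only the elements 0 < n matter. *)

Section UpperBanachDensity.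
Context {R : realType}.
Implicit Types A : set nat.

Definition window_count A (k s : nat) : nat :=
  (\sum_(k.+1 <= n < (k + s).+1) (n \in A))%N.

Definition window_limsup A (s : nat) : R :=
  limn_sup (fun k => (window_count A k s)%:R : R^o).

Definition upper_Banach_density A : R :=
  limn (fun s => window_limsup A s / s%:R).

End UpperBanachDensity.
Arguments upper_Banach_density R A : clear implicits.

(* An ultrafilter on the positive integers is an ultrafilter on nat that
   contains the set of positive integers. *)
Definition ultrafilter_pos (q : set_system nat) :=
  UltraFilter q /\ q [set n | (0 < n)%N].

Definition ultrafilter_add (q1 q2 : set_system nat) : set_system nat :=
  [set A | q1 [set n | (0 < n)%N /\
             q2 [set m | (0 < m)%N /\ A (n + m)%N]]].

Definition essential_idempotent (R : realType) (q : set_system nat) :=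
  [/\ ultrafilter_pos q, ultrafilter_add q q = q &
      forall A, q A -> 0 < upper_Banach_density R A].

Section Recurrence.
Context {X : topologicalType}.
Implicit Types (T : X -> X) (U : set X).

Definition return_set T U (r k : nat) : set X :=
  \bigcap_(j in [set j | (j <= r)%N]) (iter (j * k) T @^-1` U).

Definition topologically_multiply_recurrent T :=
  forall U, open U -> U !=set0 -> forall r : nat, (0 < r)%N ->
  exists k, (0 < k)%N /\ return_set T U r k !=set0.

Definition topologically_D_recurrent (R : realType) T :=
  exists q : set_system nat, essential_idempotent R q /\
  forall U, open U -> U !=set0 ->
  exists x : X, forall r : nat, (0 < r)%N ->
  q [set k | (0 < k)%N /\
       0 < upper_Banach_density R
             [set a | (0 < a)%N /\ return_set T U r k (iter a T x)]].

End Recurrence.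

(* Main.v *)
From HB Require Import structures.
Require Import Defs.
From mathcomp Require Import all_boot all_order all_algebra.
From mathcomp Require Import complex zify ring.
From mathcomp Require Import all_classical all_reals all_analysis.

Import Order.TTheory GRing.Theory Num.Theory.
Import numFieldNormedType.Exports.
Import ComplexField.Normc.

Local Open Scope classical_set_scope.
Local Open Scope ring_scope.
Local Open Scope complex_scope.

(** T is the weighted backward shift with weights W_(n+1) / W_n <= 2, where
    W_n = 2 ^ height n and height n is the distance from n to the largest
    number <= n of the form j! - i!, 1 <= i < j (or to 0).  There is no such
    number between l! and l * l!, so W is large near each of the multiples
    k, ..., rk of k = 2 * l!, which gives multiple recurrence.  On the other
    hand, if two iterates T^a x and T^b x, a < b, are both close to the first
    unit vector, then W_(b-a) > W_0, so b - a is not of the form j! - i!.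
    The translates by factorials of the set of such times are thus pairwise
    disjoint, and its upper Banach density vanishes. *)

(** * Sets with disjoint translates and upper Banach density *)

Lemma window_count_translates (E : set nat) (t : nat -> nat) (m k s : nat) :
  {homo t : i j / (i <= j)%N} ->
  (forall i j a b, (i < j)%N -> E a -> E b -> a <> (b + (t j - t i))%N) ->
  (m * window_count E k s <= s + t m)%N.
Proof.
move=> tmono tE.
(* [F i] is the indicator of the translate of [E] by [t i]; the guard [t i <= n] matters because
   subtraction in [nat] is truncated. By [tE], each [n] lies in at most one translate. *)
pose F i n := (t i <= n)%N && ((n - t i)%N \in E).
have F_uniq n i j : F i n -> F j n -> (i < j)%N -> False.
  move=> /andP[tin /set_mem Ei] /andP[tjn /set_mem Ej] ij.
  by have := tmono _ _ (ltnW ij) => tij; apply: (tE i j _ _ ij Ei Ej); lia.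
have F_le1 n : (\sum_(i < m) F i n <= 1)%N.
  rewrite (eq_bigr (fun i : 'I_m => if F i n then 1 else 0)%N); last first.
    by move=> i _; case: (F i n).
  rewrite -big_mkcond sum1_card; apply/card_le1_eqP => i j Fi Fj.
  apply/val_inj; have [ij|ji|//] := ltngtP i j.
    by have := F_uniq n _ _ Fi Fj ij.
  by have := F_uniq n _ _ Fj Fi ji.
(* Shifting the window by [t i <= t m] keeps it inside a common window of length [s + t m], where
   the [m] disjoint translates can be counted together. *)
have count_le i : (i < m)%N ->
    (window_count E k s <= \sum_(k.+1 <= n < (k + s + t m).+1) F i n)%N.
  move=> im; have tim := tmono _ _ (ltnW im).
  rewrite (@big_cat_nat _ _ _ (k.+1 + t i)%N)/=; [|lia|lia].
  rewrite (@big_cat_nat _ _ _ (k + s + t i).+1 (k.+1 + t i)%N)/=; [|lia|lia].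
  rewrite (leq_trans _ (leq_addl _ _))// (leq_trans _ (leq_addr _ _))//.
  rewrite big_addn (_ : (k + s + t i).+1 - t i = (k + s).+1)%N; last lia.
  by apply: leq_sum => n _; rewrite /F leq_addl addnK.
pose total := (\sum_(i < m) \sum_(k.+1 <= n < (k + s + t m).+1) F i n)%N.
rewrite (@leq_trans total)//.
  rewrite -[leqLHS](_ : \sum_(i < m) window_count E k s = _)%N; last first.
    by rewrite sum_nat_const card_ord.
  by apply: leq_sum => i _; exact: count_le.
rewrite /total exchange_big/= (leq_trans (leq_sum _ (fun n _ => F_le1 n)))//.
by rewrite sum_nat_const_nat; lia.
Qed.

Section Density.
Context {R : realType}.

(** For a bounded sequence [limn_sup] is the infimum of the suprema of the tails, each of which lies
    between 0 and [c]. *)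
Lemma limn_sup_bounds (u : nat -> R) (c : R) :
  (forall n, 0 <= u n <= c) -> 0 <= limn_sup (u : nat -> R^o) <= c.
Proof.
move=> uc.
have ubu n : has_ubound (sdrop u n).
  by exists c => _ [i _ <-]; case/andP: (uc i).
have ge0 n : 0 <= sups u n.
  have /andP[u0 _] := uc n; apply: le_trans u0 _.
  by apply: ub_le_sup => //; exists n => /=.
have bu : bounded_fun (u : nat -> R^o).
  exists c; split; first by rewrite num_real.
  move=> x cx n _; have /andP[u0 u1] := uc n.
  by rewrite /= ger0_norm// (le_trans u1)// ltW.
rewrite limn_supE//; apply/andP; split.
  by apply: lb_le_inf => [|_ [n _ <-]//]; exists (sups u 0%N), 0%N.
have lb : has_lbound (range (sups u)) by exists 0 => _ [n _ <-].
apply: (le_trans (ge_inf lb (ex_intro2 _ _ 0%N I erefl))).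
apply: ge_sup => [|_ [n _ <-]]; first by exists (u 0%N), 0%N.
by case/andP: (uc n).
Qed.

(** Since [B] is independent of the position [k], the limsup over [k] obeys the same bound:
    [window_limsup E s / s] is at most [(s + B) / (m * s)], hence at most [2 / m] once [s >= B]. *)
Lemma upper_Banach_density_eq0 (E : set nat) :
  (forall m, exists B, forall k s, (m * window_count E k s <= s + B)%N) ->
  upper_Banach_density R E = 0.
Proof.
move=> hE; apply: cvg_lim => //.
apply/cvgr0Pnorm_le => e e0.
pose m := (Num.truncn (2 / e)).+1.
have [B hB] := hE m.
have hm : 2 / e < m%:R by rewrite truncnS_gt.
have m0 : (0 : R) < m%:R by rewrite ltr0n.
exists (maxn B 1) => // s /=; rewrite geq_max => /andP[Bs s1].
have s0 : (0 : R) < s%:R by rewrite ltr0n.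
have /andP[l0 l1] : 0 <= (window_limsup E s : R) <= (s%:R + B%:R) / m%:R.
  apply: limn_sup_bounds => k; rewrite ler0n/= ler_pdivlMr// mulrC.
  by rewrite -natrM -natrD ler_nat.
rewrite ger0_norm ?divr_ge0 ?ler0n// ler_pdivrMr// (le_trans l1)//.
rewrite ler_pdivrMr// (@le_trans _ _ (2 * s%:R))//.
  by rewrite mulr_natl mulr2n lerD2l ler_nat.
rewrite mulrAC ler_pM2r// mulrC -ler_pdivrMr//; exact: ltW.
Qed.

End Density.

(** * Differences of factorials and the height function *)

Definition factorial_gap : pred nat :=
  fun d => `[< exists i j, (i < j)%N /\ d = (j.+1`! - i.+1`!)%N >].

Fixpoint height (n : nat) : nat :=
  if n is m.+1 then if factorial_gap n then 0%N else (height m).+1 else 0%N.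

Lemma heightS_le n : (height n.+1 <= (height n).+1)%N.
Proof. by rewrite /=; case: ifP. Qed.

Lemma height_factorial_gap d : factorial_gap d -> height d = 0%N.
Proof. by case: d => //= d ->. Qed.

(** A difference of factorials up to l! is less than l!. If the larger factorial is (j+1)! with j >=
    l, the difference is at least (j+1)! - j! = j * j!, hence at least l * l!. *)
Lemma factorial_gap_avoid l n : (l`! <= n < l * l`!)%N -> ~~ factorial_gap n.
Proof.
move=> /andP[ln nl]; apply/asboolP => -[i [j [ij nE]]].
have [jl|lj] := leqP j.+1 l.
  by have := leq_fact jl; have := fact_gt0 i.+1; have := fact_gt0 j.+1; lia.
have ji := leq_fact ij; have lj' : (l <= j)%N := lj.
have := leq_mul lj' (leq_fact lj').
by move: nE; rewrite factS mulSn; lia.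
Qed.

(** No reset occurs in this range, so the height grows by one at each step after l!. *)
Lemma height_ge l n : (l`! <= n < l * l`!)%N -> (n - l`! <= height n)%N.
Proof.
elim: n => [//|n IH] /andP[ln nl].
rewrite /= (negbTE (@factorial_gap_avoid l _ _)) ?ln ?nl//.
have [e|lt] := eqVneq l`! n.+1; first by rewrite e subnn.
by have := IH; lia.
Qed.

Lemma height_multiples r N M : exists k, (N < k)%N /\
  forall i n, (0 < i <= r)%N -> (n <= N)%N -> (M <= height (n + i * k))%N.
Proof.
(* The factor 2 in k = 2 * l! places each [n + i * k] at least l! >= [M] beyond l!; the summands
   [r * 2], [N] and 1 of [l] keep it below l * l!. *)
pose l := (r * 2 + N + M + 1)%N; exists (l`! * 2)%N.
have lf : (l <= l`!)%N by exact: fact_geq.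
split=> [|i n /andP[i0 ir] nN]; first lia.
apply: (@leq_trans (n + i * (l`! * 2) - l`!)); first by nia.
apply: height_ge; apply/andP; split; first nia.
have : (i * (l`! * 2) <= r * (l`! * 2))%N by rewrite leq_mul2r ir orbT.
rewrite {4}/l !mulnDl; nia.
Qed.

(** * Weighted backward shifts on an abstract sequence space *)

Lemma complex_archi_bound (R : realType) (z : R[i]) :
  0 <= z -> exists M : nat, z < M.+1%:R.
Proof.
case: z => a b; rewrite lecE /= => /andP[/eqP-> /archi_boundP aM].
exists (Num.bound a).
by rewrite -(rmorph_nat (real_complex R)) ltcR (lt_le_trans aM)// ler_nat.
Qed.

Section CoordinateSpace.
Context {R : realType} {X : normedModType R[i]}.
(** Coordinates and unit vectors are axiomatized so that a single argument serves both c_0 and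
    l^p. *)
Context (crd : X -> nat -> R[i]) (e : nat -> X).
Hypothesis crd_linear : forall a x y n,
  crd (a *: x + y) n = a * crd x n + crd y n.
Hypothesis crd_inj : forall x y, (forall n, crd x n = crd y n) -> x = y.
Hypothesis crd_le_norm : forall x n, `|crd x n| <= `|x|.
Hypothesis crd_e : forall m n, crd (e m) n = (m == n)%:R.
Hypothesis norm_e : forall n, `|e n| <= 1.
Hypothesis e_dense : forall x (eps : R), 0 < eps ->
  exists N, `|x - \sum_(n < N) crd x n *: e n| < eps%:C.

Lemma crd0 n : crd 0 n = 0.
Proof.
by have := crd_linear (-1) 0 0 n; rewrite scaler0 addr0 mulN1r addNr.
Qed.

Lemma crdZ a x n : crd (a *: x) n = a * crd x n.
Proof. by rewrite -[a *: x]addr0 crd_linear crd0 addr0. Qed.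

Lemma crdB x y n : crd (x - y) n = crd x n - crd y n.
Proof. by rewrite addrC -scaleN1r crd_linear mulN1r addrC. Qed.

(** In [c0] and [lp] this identifies the error of truncation with a tail of [x], which is how
    [e_dense] is verified there. *)
Lemma crd_truncation N x m :
  crd (x - \sum_(n < N) crd x n *: e n) m = if (m < N)%N then 0 else crd x m.
Proof.
have crdD a b : crd (a + b) m = crd a m + crd b m.
  by rewrite -{1}[a]scale1r crd_linear mul1r.
rewrite crdB (big_morph (fun z => crd z m) crdD (crd0 m)).
under eq_bigr => i _ do rewrite crdZ crd_e.
case: ifPn => [mN|mN].
  rewrite (bigD1 (Ordinal mN))//= eqxx mulr1 big1 ?addr0 ?subrr// => i.
  by rewrite -val_eqE/= => /negbTE->; rewrite mulr0.
rewrite big1 ?subr0// => i _.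
have im : (i == m :> nat) = false by apply/eqP; have := ltn_ord i; lia.
by rewrite im mulr0.
Qed.

Section WeightedShift.
Context (W : nat -> R[i]) (T : {linear X -> X}).
Hypothesis W_neq0 : forall n, W n != 0.
Hypothesis T_crd : forall x n, crd (T x) n = W n.+1 / W n * crd x n.+1.

(** The weights are written as quotients of [W] so that their products along an orbit telescope. *)
Lemma iterT_crd m x n : crd (iter m T x) n = W (n + m) / W n * crd x (n + m).
Proof.
elim: m n => [|m IH] n; first by rewrite addn0 divff// mul1r.
by rewrite iterS T_crd IH addSnnS; field; rewrite !W_neq0.
Qed.

Lemma iterT_e m n :
  iter m T (e (n + m)) = (W (n + m) / W n) *: e n.
Proof.
apply: crd_inj => i; rewrite iterT_crd crdZ !crd_e eqn_add2r eq_sym.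
by have [->|_] := eqVneq n i; rewrite ?mulr0.
Qed.

Lemma iterT_e0 m n : (n < m)%N -> iter m T (e n) = 0.
Proof.
move=> nm; apply: crd_inj => i; rewrite iterT_crd crd_e crd0.
by rewrite (_ : (n == i + m)%N = false) ?mulr0//; apply/eqP; lia.
Qed.

Lemma iterT_sum m (I : Type) (s : seq I) (P : pred I) (F : I -> X) :
  iter m T (\sum_(i <- s | P i) F i) = \sum_(i <- s | P i) iter m T (F i).
Proof. by elim: m => //= m ->; rewrite linear_sum. Qed.

Lemma iterTZ m a x : iter m T (a *: x) = a *: iter m T x.
Proof. by elim: m => //= m ->; rewrite linearZ. Qed.

(** The vector [u] adds up preimages of one truncation of [y] under the iterates of order 0, [k],
    ..., [r * k]. Each iterate brings back its own summand, and large values of [W] make the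
    summands not yet brought back small. *)
Lemma weighted_shift_multiply_recurrent :
  (forall r N M : nat, exists k, (N < k)%N /\ forall i n,
     (0 < i <= r)%N -> (n <= N)%N -> M%:R <= `|W (n + i * k)|) ->
  topologically_multiply_recurrent T.
Proof.
move=> W_large U oU [y Uy] r r0.
have /nbhs_normP[eps /= eps0 ballU] : nbhs y U by exact: open_nbhs_nbhs.
have eps2 : 0 < eps / 2 by rewrite divr_gt0.
have eps2E := RRe_real (gtr0_real eps2).
have [|N yN] := e_dense y (complex.Re (eps / 2)); first by rewrite -ltcR eps2E.
rewrite eps2E in yN.
pose C := \sum_(n < N) `|crd y n| * `|W n|.
have C0 : 0 <= C by apply: sumr_ge0 => n _; exact: mulr_ge0.
(* [M] is chosen so that [r.+1] errors of size at most [C / M.+1] add up to at most [eps / 2]. *)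
have [M CM] :=
  complex_archi_bound _ _ (divr_ge0 (mulrn_wge0 r.+1 C0) (ltW eps2)).
have [k [Nk Wk]] := W_large r N M.+1.
pose u := \sum_(i < r.+1) \sum_(n < N)
  (crd y n * W n / W (n + i * k)) *: e (n + i * k).
exists k; split; first exact: leq_ltn_trans Nk.
exists u => j /= jr; apply: ballU => /=.
pose v (i : 'I_r.+1) (n : 'I_N) :=
  (crd y n * W n / W (n + i * k)) *: iter (j * k) T (e (n + i * k)).
(* [v i n] is 0 for i < j and small for i > j; the terms with i = j add up to
   the truncation of [y]. *)
have -> : iter (j * k) T u = \sum_(i < r.+1) \sum_(n < N) v i n.
  rewrite iterT_sum; apply: eq_bigr => i _.
  by rewrite iterT_sum; apply: eq_bigr => n _; rewrite iterTZ.
pose j' : 'I_r.+1 := Ordinal (jr : (j < r.+1)%N).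
rewrite (bigD1 j')//=.
have -> : \sum_(n < N) v j' n = \sum_(n < N) crd y n *: e n.
  apply: eq_bigr => n _; rewrite /v /= iterT_e scalerA mulrA divfK//.
  by rewrite mulfK.
rewrite opprD addrA (le_lt_trans (ler_normB _ _))// [ltRHS](splitr eps).
rewrite ltr_leD//.
have v_le (i : 'I_r.+1) (n : 'I_N) : i != j :> nat ->
    `|v i n| <= `|crd y n| * `|W n| / M.+1%:R.
  move=> ij; have [lt|gt|/eqP] := ltngtP i j; last by rewrite (negbTE ij).
    (* Since [n < N < k], the index [n + i * k] is below [j * k], and the unit vector is shifted
       out. *)
    rewrite /v iterT_e0 ?scaler0 ?normr0 ?divr_ge0 ?mulr_ge0//.
    have := ltn_ord n; nia.
  pose m := (n + (i - j) * k)%N.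
  have -> : v i n = (crd y n * W n / W m) *: e m.
    rewrite /v (_ : n + i * k = m + j * k)%N; last first.
      by rewrite -addnA -mulnDl subnK// ltnW.
    by rewrite iterT_e scalerA mulrA divfK.
  have mM : M.+1%:R <= `|W m|.
    by apply: Wk; have := ltn_ord i; have := ltn_ord n; lia.
  rewrite normrZ normf_div normrM -[leRHS]mulr1 ler_pM ?divr_ge0 ?mulr_ge0//.
  rewrite ler_wpM2l ?mulr_ge0// lef_pV2// posrE ?ltr0Sn//.
  exact: lt_le_trans mM.
apply: (@le_trans _ _ (\sum_(i < r.+1) C / M.+1%:R)).
  rewrite (le_trans (ler_norm_sum _ _ _))//.
  rewrite [leRHS](bigID (fun i => i != j'))/=.
  rewrite -[leLHS]addr0 lerD//; last first.
    by apply: sumr_ge0 => i _; rewrite divr_ge0.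
  apply: ler_sum => i ij; rewrite (le_trans (ler_norm_sum _ _ _))// mulr_suml.
  by apply: ler_sum => n _; exact: v_le.
rewrite sumr_const card_ord -mulrnAl ler_pdivrMr// mulrC -ler_pdivrMr //.
exact: ltW.
Qed.

(** Coordinate 0 of the later iterate is [W (b - a) / W 0] times coordinate [b - a] of the earlier
    one, hence smaller than 1/2 in modulus. It cannot then be within 1/2 of 1. *)
Lemma weighted_shift_return_gap x a b :
  (a < b)%N -> `|W (b - a)| <= `|W 0%N| ->
  `|iter a T x - e 0%N| < 2^-1 -> `|iter b T x - e 0%N| < 2^-1 -> False.
Proof.
move=> ab Wba xa xb; set m := (b - a)%N in Wba *.
have xam : `|crd (iter a T x) m| < 2^-1.
  apply: le_lt_trans xa; apply: le_trans (crd_le_norm _ m).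
  by rewrite crdB crd_e (_ : (0%N == m) = false) ?subr0//; apply/eqP; lia.
have xb0 : `|crd (iter b T x) 0%N - 1| < 2^-1.
  apply: le_lt_trans xb; apply: le_trans (crd_le_norm _ 0%N).
  by rewrite crdB crd_e.
have xb_le : `|crd (iter b T x) 0%N| <= `|crd (iter a T x) m|.
  have -> : b = (m + a)%N by lia.
  rewrite iterD iterT_crd add0n normrM normf_div ler_piMl//.
  by rewrite ler_pdivrMr ?normr_gt0// mul1r.
have : `|1 : R[i]| < 1.
  have {1}-> : 1 = crd (iter b T x) 0%N - (crd (iter b T x) 0%N - 1).
    by rewrite subKr.
  rewrite (le_lt_trans (ler_normB _ _))// [ltRHS]splitr !mul1r ltrD//.
  exact: le_lt_trans xam.
by rewrite normr1 ltxx.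
Qed.

(** Visits of an orbit near [e 0] are never [t j - t i] apart, so the translates of the set of
    visits by the [t i] are disjoint and its density is 0, whereas recurrence would provide a set of
    visits of positive density. *)
Lemma weighted_shift_not_D_recurrent (t : nat -> nat) :
  {homo t : i j / (i < j)%N} ->
  (forall i j, (i < j)%N -> `|W (t j - t i)| <= `|W 0%N|) ->
  ~ topologically_D_recurrent R T.
Proof.
move=> t_incr Wt [q [[[ultra_q _] _ _]]].
have near_e0 : nbhs (e 0%N) (ball (e 0%N) (2^-1 : R[i])).
  by apply: nbhsx_ballx; rewrite invr_gt0.
have ball_e0 : (ball (e 0%N) (2^-1 : R[i]))^° !=set0 by exists (e 0%N).
move=> /(_ _ (open_interior _) ball_e0)[x /(_ 1%N isT)].
move=> /filter_ex[k [_]].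
set E := [set a | _]; rewrite (@upper_Banach_density_eq0 _ E) ?ltxx// => m.
(* The term [j = 0] of the return set says that [iter a T x] itself lies in the ball. *)
have E_near a : E a -> `|iter a T x - e 0%N| < 2^-1.
  by move=> [_ /(_ 0%N isT)] /= /interior_subset; rewrite -ball_normE/= distrC.
exists (t m) => l s; apply: window_count_translates.
  by apply: homo_leq => // [? ? ?|i]; [exact: leq_trans | exact/ltnW/t_incr].
move=> i j a b ij /E_near xa /E_near xb ab; move: xa; rewrite ab => xa.
have tij := t_incr _ _ ij.
apply: (weighted_shift_return_gap x b (b + (t j - t i))%N _ _ xb xa); first lia.
by rewrite addKn Wt.
Qed.

End WeightedShift.

Hypothesis shift : forall w : nat -> R[i], (forall n, normc (w n) <= 2) ->
  exists S : X -> X, (forall x n, crd (S x) n = w n * crd x n.+1) /\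
                     (forall x, `|S x| <= 2 * `|x|).

Lemma exists_recurrent_shift : exists T : {linear X -> X},
  [/\ continuous T, topologically_multiply_recurrent T &
      ~ topologically_D_recurrent R T].
Proof.
pose W n : R[i] := 2 ^+ height n.
have W_neq0 n : W n != 0 by rewrite expf_neq0// pnatr_eq0.
have normW n : `|W n| = 2 ^+ height n by rewrite normrX normr_nat.
have w_le2 n : normc (W n.+1 / W n) <= 2.
  rewrite -lecR -normr_normc normf_div !normW ler_pdivrMr ?exprn_gt0//.
  rewrite (rmorph_nat (real_complex R)) -exprS ler_weXn2l ?ler1n//.
  exact: heightS_le.
have [S [crdS S_le]] := shift _ w_le2.
have S_linear : linear S.
  move=> a x y; apply: crd_inj => n.
  by rewrite crd_linear !crdS crd_linear; ring.
pose T : {linear X -> X} := HB.pack S (GRing.isLinear.Build _ _ _ _ _ S_linear).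
exists T; split.
- apply/bounded_linear_continuous/linear_boundedP; near=> r => x.
  by rewrite (le_trans (S_le x))// ler_wpM2r.
- apply: (weighted_shift_multiply_recurrent W T W_neq0 crdS) => r N M.
  have [k [Nk hk]] := height_multiples r N M; exists k; split=> // i n i0r nN.
  rewrite normW (@le_trans _ _ (2 ^+ M))//.
    by rewrite -natrX ler_nat ltnW// ltn_expl.
  by rewrite ler_weXn2l ?ler1n// hk.
(* The translations are the factorials from 1! on: at their differences the height is 0, so [W]
   takes there the value 1, which is also [W 0]. *)
- apply: (weighted_shift_not_D_recurrent W T W_neq0 crdS (fun i => i.+1`!)).
    by move=> i j ij; rewrite ltn_fact.
  move=> i j ij; rewrite !normW height_factorial_gap//.
  by apply/asboolP; exists i, j.
Unshelve. all: by end_near. Qed.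

End CoordinateSpace.

(** * The space c_0 *)

Section C0.
Context {R : realType}.

Definition unit_seq (m n : nat) : R[i] := (m == n)%:R.

Definition shift_seq (w x : nat -> R[i]) : nat -> R[i] :=
  fun n => w n * x n.+1.

Lemma normc_unit_seq m n : normc (unit_seq m n) = (m == n)%:R.
Proof. by rewrite /unit_seq; case: eqP; rewrite ?normc1 ?normc0. Qed.

Lemma unit_seq_c0 m : unit_seq m \in c0_pred R.
Proof.
apply/c0P/cvgr0Pnorm_lt => eps eps0; exists m.+1 => // n /= mn.
by rewrite normc_unit_seq (_ : (m == n) = false) ?normr0//; apply/eqP; lia.
Qed.

Lemma shift_seq_c0 w x : (forall n, normc (w n) <= 2) ->
  x \in c0_pred R -> shift_seq w x \in c0_pred R.
Proof.
move=> w2 /c0P x0; apply/c0P.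
apply: (@squeeze_cvgr _ _ _ _ (cst 0) (fun n => 2 * normc (x n.+1))).
- near=> n; rewrite normc_ge0/= /shift_seq normcM.
  by rewrite ler_wpM2r ?normc_ge0.
- exact: cvg_cst.
- rewrite -[X in _ --> X](mulr0 2); apply: cvgMl_tmp.
  by move: x0; rewrite -(cvg_shiftS).
Unshelve. all: by end_near. Qed.

Lemma c0_recurrent_shift : exists T : {linear c0 R -> c0 R},
  [/\ continuous T, topologically_multiply_recurrent T &
      ~ topologically_D_recurrent R T].
Proof.
pose e m := C0 (unit_seq_c0 m).
have crd_linear a (x y : c0 R) n : (a *: x + y) n = a * x n + y n by [].
have crd_e m n : e m n = (m == n)%:R by [].
apply: (@exists_recurrent_shift _ (c0 R) (fun x => x : nat -> R[i]) e) => //.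
- by move=> x y xy; apply: (@val_inj _ _ (c0 R)); exact/funext.
- by move=> x n; rewrite c0_normE normr_normc lecR normc_le_c0_norm// c0_valP.
- move=> n; rewrite c0_normE -[leRHS](rmorph1 (real_complex R)) lecR.
  apply: c0_norm_le => m; rewrite normc_unit_seq.
  by case: eqP.
- move=> x eps eps0.
  (* Half of [eps] is used because a supremum of terms below a bound may equal that bound. *)
  have /c0P/cvgr0Pnorm_lt/(_ (eps / 2))[|N _ xN] := c0_valP x.
    by rewrite divr_gt0.
  exists N; rewrite c0_normE ltcR (@le_lt_trans _ _ (eps / 2))//; last first.
    by rewrite ltr_pdivrMr// ltr_pMr// ltr1n.
  apply: c0_norm_le => n.
  rewrite (@crd_truncation _ (c0 R) (fun x => x) e crd_linear crd_e).
  case: ltnP => [_|/xN/ltW]; first by rewrite normc0 divr_ge0 ?ltW.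
  by rewrite ger0_norm// normc_ge0.
- move=> w w2.
  exists (fun x => C0 (shift_seq_c0 _ _ w2 (c0_valP x))); split=> // x.
  rewrite !c0_normE -(rmorph_nat (real_complex R)) -rmorphM lecR.
  apply: c0_norm_le => n; rewrite /= /shift_seq normcM.
  by rewrite ler_pM ?normc_ge0// normc_le_c0_norm// c0_valP.
Qed.

End C0.

(** * The spaces l^p *)

Section Lp.
Context {R : realType} (p : R) (p1 : 1 <= p).

Let p0 : 0 < p. Proof. exact: lt_le_trans p1. Qed.

Lemma lp_sum_unit_seq m : lp_sum p (unit_seq m : nat -> R[i]) = 1%E.
Proof.
rewrite /lp_sum (nneseriesD1 (n := m))//; last first.
  by move=> k _; rewrite lee_fin powR_ge0.
rewrite normc_unit_seq eqxx powR1 eseries0 ?adde0// => k _ km.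
by rewrite normc_unit_seq eq_sym (negbTE km) powR0// gt_eqF.
Qed.

Lemma unit_seq_lp m : unit_seq m \in lp_pred p1.
Proof. by rewrite /in_mem/= /lp_pred lp_sum_unit_seq ltry. Qed.

(** The terms on the left are dominated by those of [2 *: x] from index 1 on. Comparing with a
    multiple of [x] yields both membership in l^p and the norm bound, by homogeneity. *)
Lemma lp_sum_shift_seq (w x : nat -> R[i]) : (forall n, normc (w n) <= 2) ->
  (lp_sum p (shift_seq w x) <= lp_sum p (2 *: x))%E.
Proof.
move=> w2; have pow_ge0 n : (0 <= (normc ((2 *: x) n) `^ p)%:E)%E.
  by rewrite lee_fin powR_ge0.
rewrite [leRHS]nneseries_recl// -[X in (_ + X)%E]nneseries_addn//.
rewrite (le_trans _ (leeDr _ _))//.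
apply: lee_nneseries => [n _ _|n _]; first by rewrite lee_fin powR_ge0.
rewrite lee_fin ge0_ler_powR ?nnegrE ?normc_ge0 ?(ltW p0)//.
rewrite addn1 /shift_seq !normcM ler_wpM2r ?normc_ge0//.
by rewrite (le_trans (w2 n))// -lecR -normr_normc normr_nat rmorph_nat.
Qed.

Lemma shift_seq_lp w x : (forall n, normc (w n) <= 2) ->
  x \in lp_pred p1 -> shift_seq w x \in lp_pred p1.
Proof.
move=> w2 xlp; rewrite /in_mem/= /lp_pred.
rewrite (le_lt_trans (lp_sum_shift_seq _ _ w2))//.
exact: (rpredZ 2 xlp).
Qed.

Lemma le_lp_norm (x y : nat -> R[i]) : y \in lp_pred p1 ->
  (lp_sum p x <= lp_sum p y)%E -> lp_norm p x <= lp_norm p y.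
Proof.
move=> ylp xy; rewrite ge0_ler_powR ?nnegrE ?invr_ge0 ?(ltW p0)//.
- by rewrite fine_ge0// lp_sum_ge0.
- by rewrite fine_ge0// lp_sum_ge0.
rewrite fine_le ?(lp_sum_fin (p1 := p1))//.
by rewrite /in_mem/= /lp_pred (le_lt_trans xy).
Qed.

Lemma lp_recurrent_shift : exists T : {linear lp p1 -> lp p1},
  [/\ continuous T, topologically_multiply_recurrent T &
      ~ topologically_D_recurrent R T].
Proof.
pose e m := Lp (unit_seq_lp m).
have crd_linear a (x y : lp p1) n : (a *: x + y) n = a * x n + y n by [].
have crd_e m n : e m n = (m == n)%:R by [].
apply: (@exists_recurrent_shift _ (lp p1) (fun x => x : nat -> R[i]) e) => //.
- by move=> x y xy; apply: (@val_inj _ _ (lp p1)); exact/funext.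
- move=> x n; rewrite lp_normE normr_normc lecR.
  by rewrite (normc_le_lp_norm (p1 := p1))// lp_valP.
- by move=> n; rewrite lp_normE /lp_norm lp_sum_unit_seq powR1.
- move=> x eps eps0.
  (* The tail of the series of p-th powers is made smaller than [eps] to the power [p]; the root is
     taken at the end. *)
  have epsp : 0 < eps `^ p by rewrite powR_gt0.
  have pow_ge0 k : (0 <= (normc (x k) `^ p)%:E)%E by rewrite lee_fin powR_ge0.
  have := nneseries_tail_cvg (lp_valP x) (fun k _ => pow_ge0 k).
  move=> /fine_cvgP[_ /cvgr0Pnorm_lt /(_ _ epsp)[N _]].
  move=> /(_ N (leqnn N))/= tailN.
  exists N; set z : lp p1 := (X in `|X|).
  have trunc k : z k = if (k < N)%N then 0 else x k
    := @crd_truncation _ (lp p1) (fun x => x) e crd_linear crd_e N x k.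
  clearbody z; rewrite lp_normE ltcR /lp_norm.
  have -> : lp_sum p z = (\sum_(N <= k <oo) (normc (x k) `^ p)%:E)%E.
    rewrite /lp_sum (nneseries_split 0 N); last first.
      by move=> k _; rewrite lee_fin powR_ge0.
    rewrite add0n big_nat big1 ?add0e => [|k /andP[_ kN]]; last first.
      by rewrite trunc kN normc0 powR0// gt_eqF.
    rewrite eseries_cond [RHS]eseries_cond.
    by apply: eq_eseriesr => k /= Nk; rewrite trunc ltnNge Nk.
  move: tailN; rewrite ger0_norm ?fine_ge0 ?nneseries_ge0// => tailN.
  rewrite -[ltRHS](powRr1 (ltW eps0)) -(mulfV (lt0r_neq0 p0)) powRrM.
  rewrite gt0_ltr_powR ?invr_gt0 ?nnegrE ?powR_ge0//.
  by rewrite fine_ge0// nneseries_ge0.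
- move=> w w2.
  exists (fun x => Lp (shift_seq_lp _ _ w2 (lp_valP x))); split=> // x.
  rewrite -[2 in leRHS]normr_nat -normrZ !lp_normE lecR.
  by rewrite le_lp_norm ?lp_sum_shift_seq// lp_valP.
Qed.

End Lp.

Theorem proposition6 (R : realType) :
  (exists T : {linear c0 R -> c0 R},
     [/\ continuous T, topologically_multiply_recurrent T &
         ~ topologically_D_recurrent R T]) /\
  (forall (p : R) (p1 : 1 <= p),
     exists T : {linear lp p1 -> lp p1},
       [/\ continuous T, topologically_multiply_recurrent T &
           ~ topologically_D_recurrent R T]).
Proof. by split; [exact: c0_recurrent_shift | exact: lp_recurrent_shift]. Qed.
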